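(* Let $\lambda,\mu>0$ and let $n,k\ge 1$ be integers. Let $O^{(1)}_{n,n+k}$ and $O^{(2)}_{n,n+k}$ be the overlap times of the $n$-th and $(n+k)$-th customers in stations 1 and 2 of the $(M/M/\infty)^2$ tandem queue with arrival rate $\lambda$ and with both stations having exponential service times of the same rate $\mu$. Then $$\mathbb{E}\left[O^{(1)}_{n,n+k}\right]=\left(\frac{\lambda}{\lambda+\mu}\right)^k\frac{1}{2\mu},$$ $$\mathbb{E}\left[O^{(2)}_{n,n+k}\right]=\frac{1}{4\mu}\left(\frac{\lambda}{\lambda+\mu}\right)^{k}+\frac{k}{4}\left(\frac{\lambda}{\lambda+\mu}\right)^{k}\left(\frac{1}{\lambda+\mu}\right),$$ $$\mathrm{Var}\left[O^{(1)}_{n,n+k}\right]=\left(\frac{\lambda}{\lambda+\mu}\right)^k\frac{1}{2\mu^2}-\left(\frac{\lambda}{\lambda+\mu}\right)^{2k}\frac{1}{4\mu^2},$$ $$\mathrm{Var}\left[O^{(2)}_{n,n+k}\right]=\left(\frac{\lambda}{\lambda+\mu}\right)^k\frac{1}{4\mu^2}+\frac{1}{4\mu^2}\left(\frac{\lambda}{\lambda+\mu}\right)^{k}\left(\frac{\mu}{\lambda+\mu}\right)k-\left(\frac{1}{4\mu}\left(\frac{\lambda}{\lambda+\mu}\right)^{k}+\frac{k}{4}\left(\frac{\lambda}{\lambda+\mu}\right)^{k}\left(\frac{1}{\lambda+\mu}\right)\right)^2,$$ $$\mathrm{Cov}\left[O^{(1)}_{n,n+k},O^{(2)}_{n,n+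k}\right]=\frac{1}{8\mu^2}\left(\frac{\lambda}{\lambda+\mu}\right)^k-\frac{1}{8\mu^2}\left(\frac{\lambda}{\lambda+\mu}\right)^{2k}\left(1+\frac{k\mu}{\lambda+\mu}\right).$$
   Context: The $(M/M/\infty)^2$ tandem queue with identically distributed stations: customers $1,2,3,\dots$ arrive at station 1 at the successive points $A_1<A_2<\cdots$ of a Poisson process of rate $\lambda$, so the inter-arrival times $A_{i+1}-A_i$ are i.i.d. exponential with rate $\lambda$. Each station has infinitely many servers; customer $i$ receives service of duration $S^{(1)}_i$ at station 1 starting at time $A_i$, then immediately moves to station 2 and receives service of duration $S^{(2)}_i$. All service times $S^{(j)}_i$ ($j=1,2$, $i\ge 1$) are i.i.d. exponential with rate $\mu$ (mean $1/\mu$) and independent of the arrival process. Put $D^{(0)}_i=A_i$ and $D^{(j)}_i=A_i+\sum_{l=1}^{j}S^{(l)}_i$, the departure time of customer $i$ from station $j$. The overlap time of customers $n$ and $n+k$ in station $j$ is $$O^{(j)}_{n,n+k}=\left(\min\left(D^{(j)}_n,D^{(j)}_{n+k}\right)-\max\left(D^{(j-1)}_n,D^{(j-1)}_{n+k}\right)\right)^+,\qquad j=1,2,$$ where $z^+=\max(z,0)$. *)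

(* Defs.v *)
From HB Require Import structures.
From mathcomp Require Export all_boot all_order all_algebra.
From mathcomp Require Export finmap.
From mathcomp Require Export all_classical all_reals all_analysis.
(* Re-imported last so that the ring structure of {mfun T >-> R} is inferred. *)
From mathcomp Require Export measurable_realfun.
Set Implicit Arguments.
Unset Strict Implicit.
Unset Printing Implicit Defensive.
Import Order.TTheory GRing.Theory Num.Theory.
Import numFieldNormedType.Exports.
Local Open Scope classical_set_scope.
Local Open Scope ring_scope.

Section Independence.
Context d (T : measurableType d) (R : realType) (P : probability T R).

Definition mutually_independent (I : choiceType) (D : set I)
    (X : I -> {RV P >-> R}) : Prop :=
  forall (J : {fset I}) (B : I -> set R),
    [set` J] `<=` D ->
    (forall i, i \in J -> measurable (B i)) ->
    P (\bigcap_(i in [set` J]) (X i @^-1` B i)) =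
      (\prod_(i <- J) P (X i @^-1` B i))%E.

Definition generated_sigma_algebra (I : Type) (D : set I)
    (X : I -> {RV P >-> R}) : set (set T) :=
  <<s \bigcup_(i in D) preimage_set_system setT (X i) measurable >>.

Definition independent_families (I1 I2 : Type) (D1 : set I1) (D2 : set I2)
    (X : I1 -> {RV P >-> R}) (Y : I2 -> {RV P >-> R}) : Prop :=
  forall E F : set T,
    generated_sigma_algebra D1 X E -> generated_sigma_algebra D2 Y F ->
    P (E `&` F) = (P E * P F)%E.

Definition has_exponential_law (rate : R) (X : {RV P >-> R}) : Prop :=
  forall B : set R, measurable B -> distribution P X B = exponential_prob rate B.

Definition iid_exponential (I : choiceType) (D : set I) (rate : R)
    (X : I -> {RV P >-> R}) : Prop :=
  mutually_independent D X /\ forall i, D i -> has_exponential_law rate (X i).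

End Independence.

(* Customers and stations are numbered from 1; the values [A 0], [S 0 _] and
   [S _ 0] are never used. *)
Section TandemQueue.
Context d (T : measurableType d) (R : realType) (P : probability T R).

(* The process starts at time 0, so the gap before the first point is [A 1]. *)
Definition interarrival (A : nat -> {RV P >-> R}) (i : nat) : {RV P >-> R} :=
  if i is 0%N then A 1%N else A i.+1 - A i.

(* Exponential gaps are almost surely positive, so the points of the process
   are almost surely strictly increasing. *)
Definition poisson_process_points (rate : R) (A : nat -> {RV P >-> R}) : Prop :=
  iid_exponential [set: nat] rate (interarrival A).

Definition service_index : set (nat * nat) :=
  [set ji | (1 <= ji.1 <= 2)%N /\ (1 <= ji.2)%N].

(* [S j i] is the service time of customer i at station j. *)
Record is_tandem_queue (lambda mu : R) (A : nat -> {RV P >-> R})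
    (S : nat -> nat -> {RV P >-> R}) : Prop := {
  tandem_arrivals : poisson_process_points lambda A ;
  tandem_services :
    iid_exponential service_index mu (fun ji : nat * nat => S ji.1 ji.2) ;
  tandem_independent :
    independent_families [set i | (1 <= i)%N] service_index
      A (fun ji : nat * nat => S ji.1 ji.2)
}.

Definition departure (A : nat -> {RV P >-> R}) (S : nat -> nat -> {RV P >-> R})
    (j i : nat) (w : T) : R :=
  A i w + \sum_(1 <= l < j.+1) S l i w.

Definition overlap (A : nat -> {RV P >-> R}) (S : nat -> nat -> {RV P >-> R})
    (j m n : nat) (w : T) : R :=
  Num.max
    (Num.min (departure A S j m w) (departure A S j n w)
     - Num.max (departure A S j.-1 m w) (departure A S j.-1 n w))
    0.

End TandemQueue.

(* Main.v *)
From HB Require Import structures.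
Require Import Defs.
From mathcomp Require Import ring lra.
Set Implicit Arguments.
Unset Strict Implicit.
Unset Printing Implicit Defensive.
Import Order.TTheory GRing.Theory Num.Theory.
Import numFieldNormedType.Exports.
Local Open Scope classical_set_scope.
Local Open Scope ring_scope.

(** Two customers who enter a station with a time lag [delta] and need services
    [x] and [y] there overlap during [station_overlap delta x y], which vanishes
    unless the earlier one is still present when the later one arrives.  With
    exponential services of rate mu this has probability
    [exp (- mu * |delta|)], and then, by memorylessness, the overlap is the
    minimum of two fresh exponential times, i.e. an exponential time of rate
    [2 * mu].  Hence, for p = 1, 2, the p-th moment of the overlap given the lag
    is [p! / (2 * mu)^p * exp (- mu * |delta|)] ([station_overlap_moment]).

    This applies to both stations.  At station 1 the lag is
    [G = A (n + k) - A n], and at station 2 it is [G + y - x], where [x], [y]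
    are the services at station 1.  Since the services at station 2 are
    independent of this lag, everything reduces to expectations of
    [exp (- mu * |G + y - x|)], possibly weighted by the first overlap.  Given
    [G = g >= 0], either customer n leaves station 1 before the arrival of
    customer n + k, or memorylessness turns [x] and [y] into a symmetric race,
    whose minimum and absolute difference are independent
    ([exponential_race]).  This gives [(1 + mu * g) / 2 * exp (- mu * g)]
    without weight ([expRN_next_gap]) and [exp (- mu * g) / (4 * mu)] with the
    first overlap as weight ([station_overlap_next]).

    It remains to average [(a + b * G) * exp (- mu * G)] over a sum of k
    independent exponential times of rate lambda.  Averaging over one of them
    keeps this form and only changes [a] and [b], so that induction on k gives
    [(lambda / (lambda + mu))^k * (a + b * k / (lambda + mu))]
    ([integral_gap]).

    The independence used above is between vectors, while the hypotheses speak
    of product formulas for coordinates.  The bridge is [independent_of_pair]: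
    coordinates are adjoined one at a time, keeping independence from the
    cylinder events of all the coordinates still to come. *)

(** * Integration against a density *)

Section density.
Local Open Scope ereal_scope.
Context d (T : measurableType d) (R : realType).
Variables (m nu : {measure set T -> \bar R}) (p : T -> R).
Hypotheses (mp : measurable_fun setT p) (p0 : forall x, (0 <= p x)%R).
Hypothesis nuE : forall B, measurable B -> nu B = \int[m]_(x in B) (p x)%:E.
Import HBNNSimple.

(** Both sides are additive and continuous along increasing sequences, so the
    equality on indicators, which is the hypothesis, propagates through simple
    functions. *)
Lemma ge0_integral_density (f : T -> \bar R) :
  measurable_fun setT f -> (forall x, 0 <= f x) ->
  \int[nu]_x f x = \int[m]_x (f x * (p x)%:E).
Proof.
move=> mf f0.
pose f_ := nnsfun_approx measurableT mf.
transitivity (limn (fun n => \int[nu]_x (f_ n x)%:E)).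
  rewrite -monotone_convergence//.
  - apply: eq_integral => y _; apply/esym/cvg_lim => //.
    exact: cvg_nnsfun_approx.
  - by move=> n; exact/measurable_EFinP/measurable_funP.
  - by move=> n y _; rewrite lee_fin.
  - by move=> y _ a b ab; rewrite lee_fin; exact/lefP/nd_nnsfun_approx.
rewrite [X in limn X](_ : _ = (fun n => \int[m]_x ((f_ n x)%:E * (p x)%:E))).
  rewrite -monotone_convergence//; last 3 first.
    - move=> n; apply: emeasurable_funM; first exact/measurable_EFinP.
      exact/measurable_EFinP.
    - by move=> n x _; rewrite mule_ge0// lee_fin.
    - move=> x _ a b ab; apply: lee_pmul => //; rewrite ?lee_fin//.
      exact/lefP/nd_nnsfun_approx.
  apply: eq_integral => x _.
  apply/cvg_lim => //.
  by apply: cvgeZr => //; exact: cvg_nnsfun_approx.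
apply/funext => n.
transitivity (\sum_(k \in range (f_ n))
    \int[m]_x ((k * \1_(f_ n @^-1` [set k]) x)%:E * (p x)%:E)).
  under eq_integral do rewrite fimfunE -fsumEFin//.
  rewrite ge0_integral_fsum//; last 2 first.
  - by move=> y; exact/measurable_EFinP/measurable_funM.
  - by move=> y x _; rewrite nnfun_muleindic_ge0.
  apply: eq_fsbigr => r /set_mem[y _ fyr].
  rewrite integralZl_indic_nnsfun// integral_indic//= setIT.
  rewrite nuE// [in LHS]integral_mkcond epatch_indic -ge0_integralZl//; last 3 first.
  - apply: emeasurable_funM; first exact/measurable_EFinP.
    exact/measurable_EFinP.
  - by move=> x _; rewrite mule_ge0// lee_fin.
  - by rewrite lee_fin -fyr.
  by apply: eq_integral => x _ /=; rewrite EFinM -muleA; congr (_ * _); rewrite muleC.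
rewrite -ge0_integral_fsum//.
- apply: eq_integral => x _; rewrite -ge0_mule_fsuml//; last first.
    by move=> r; rewrite nnfun_muleindic_ge0.
  by rewrite fsumEFin// -fimfunE.
- move=> r; apply: emeasurable_funM => //.
  exact/measurable_EFinP/measurable_funM.
  exact/measurable_EFinP.
- move=> r x _; apply: mule_ge0; last by rewrite lee_fin.
  by rewrite EFinM nnfun_muleindic_ge0.
Qed.
End density.

(** * Translations and exponential integrals on the half-line *)

Section lebesgue_translation.
Context {R : realType}.
Local Notation leb := (@lebesgue_measure R).

Lemma lebesgue_measure_shift (g : R) (B : set R) : measurable B ->
  pushforward leb ((fun x => x + g)%R : R -> measurableTypeR R) B = leb B.
Proof.
move=> mB; apply/esym/lebesgue_measure_unique => //=.
  exact: measurable_funD.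
move=> mf _ [[a b]] _ <-.
rewrite /pushforward.
have -> : (fun x => x + g) @^-1` `]a, b]%classic = `](a - g), (b - g)]%classic.
  by apply/seteqP; split => x /=; rewrite !in_itv/= lerBrDr ltrBlDr.
rewrite !lebesgue_measure_itv/= !lte_fin ltrD2r; case: ifPn => // _.
by rewrite -!EFinD; congr EFin; lra.
Qed.

Lemma ge0_integral_shift (g : R) (f : R -> \bar R) :
  measurable_fun setT f -> (forall x, 0 <= f x)%E ->
  (\int[leb]_(x in `[g, +oo[) f x = \int[leb]_(x in `[0%R, +oo[) f (x + g)%R)%E.
Proof.
move=> mf f0.
have ms : measurable_fun setT ((fun x => x + g)%R : R -> measurableTypeR R).
  exact: measurable_funD.
rewrite (_ : `[0%R, +oo[%classic =
    ((fun x => x + g)%R : R -> measurableTypeR R) @^-1` `[g, +oo[); last first.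
  by apply/seteqP; split => x /=; rewrite !in_itv/= !andbT lerDr.
transitivity (\int[pushforward leb
    ((fun x => x + g)%R : R -> measurableTypeR R)]_(x in `[g, +oo[) f x)%E.
  by apply: eq_measure_integral => //= A mA AS; exact/esym/lebesgue_measure_shift.
rewrite ge0_integral_pushforward//=.
exact: measurable_funS mf.
Qed.
End lebesgue_translation.

Section exponential_moments.
Context {R : realType}.
Local Notation leb := (@lebesgue_measure R).

(** The term of order [n + 1] of the series of [exp (theta * x)] alone beats
    [x ^ n] by a factor of order [x]. *)
Lemma cvg_pow_expRN (n : nat) (theta : R) : 0 < theta ->
  x ^+ n * expR (- theta * x) @[x --> +oo%R] --> (0 : R).
Proof.
move=> theta0.
(* From [(theta * x)^(n+1) / (n+1)! <= exp (theta * x)]. *)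
pose c := n.+1`!%:R / theta ^+ n.+1.
have c0 : 0 < c by rewrite divr_gt0 ?exprn_gt0// ltr0n fact_gt0.
apply: (@squeeze_cvgr _ _ _ _ (fun=> 0) (fun x => c / x)); last 2 first.
- exact: cvg_cst.
- rewrite -(mulr0 c); apply: cvgMl_tmp.
  apply/cvgrVy; first by near=> x; rewrite invr_gt0.
  by under eq_cvg do rewrite /unstable.inv_fun invrK.
near=> x.
have x0 : 0 < x by [].
rewrite mulr_ge0 ?expR_ge0 ?exprn_ge0 ?ltW//=.
rewrite mulNr expRN ltr_pdivrMr ?expR_gt0//.
have := @expR_ge1Dxn _ (theta * x) n (mulr_ge0 (ltW theta0) (ltW x0)).
have cx0 : 0 < c / x by rewrite divr_gt0.
rewrite -(ler_pM2l cx0); apply: lt_le_trans.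
rewrite mulrDr mulr1.
have -> : c / x * ((theta * x) ^+ n.+1 / n.+1`!%:R) = x ^+ n.
  rewrite /c exprMn [x ^+ n.+1]exprS.
  have fac : n.+1`!%:R != 0 :> R by rewrite pnatr_eq0 -lt0n fact_gt0.
  have tn : theta ^+ n.+1 != 0 by rewrite expf_eq0/= gt_eqF.
  by field; rewrite fac tn gt_eqF.
by rewrite ltrDr.
Unshelve. all: by end_near. Qed.

(** Degree two is what second moments of overlaps require. *)
Lemma integral_poly2_expRN (theta a b c : R) : 0 < theta ->
  0 <= a -> 0 <= b -> 0 <= c ->
  (\int[leb]_(x in `[0%R, +oo[)
    ((a + b * x + c * x ^+ 2) * expR (- theta * x))%:E =
  (a / theta + b / theta ^+ 2 + 2 * c / theta ^+ 3)%:E)%E.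
Proof.
move=> t0 a0 b0 c0.
(* The primitive given by repeated integration by parts. *)
pose F x := - ((a / theta + b / theta ^+ 2 + 2 * c / theta ^+ 3)
  * (x ^+ 0 * expR (- theta * x))
  + (b / theta + 2 * c / theta ^+ 2) * (x ^+ 1 * expR (- theta * x))
  + c / theta * (x ^+ 2 * expR (- theta * x))).
have de (x : R) : is_derive x 1 (fun y : R => expR (- theta * y))
    (- theta * expR (- theta * x)).
  have dl : is_derive x 1 (fun y : R => - theta * y) (- theta).
    by have := @is_deriveZ _ _ _ (@id R) (- theta) x 1 1 (is_derive_id _ _);
      rewrite /GRing.scale/= mulr1.
  have := @is_derive1_comp _ (@expR R) _ x _ _ (is_derive_expR _) dl.
  by rewrite mulrC.
have dn (n : nat) (x : R) : is_derive x 1 (fun y : R => y ^+ n * expR (- theta * y))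
    ((n%:R * x ^+ n.-1 - theta * x ^+ n) * expR (- theta * x)).
  have := @is_deriveM _ _ ((@id R) ^+ n) _ x 1 _ _
    (is_deriveX n (is_derive_id x 1)) (de x).
  rewrite [X in is_derive _ _ X](_ : _ =
      (fun y : R => y ^+ n * expR (- theta * y))); last first.
    by apply/funext => y; rewrite fctE exprfctE.
  move=> h; apply: is_derive_eq h _.
  by rewrite exprfctE /GRing.scale/=; ring.
have dF (x : R) : is_derive x 1 F ((a + b * x + c * x ^+ 2) * expR (- theta * x)).
  have := is_deriveN (is_deriveD (is_deriveD
    (is_deriveZ (a / theta + b / theta ^+ 2 + 2 * c / theta ^+ 3) (dn 0%N x))
    (is_deriveZ (b / theta + 2 * c / theta ^+ 2) (dn 1%N x)))
    (is_deriveZ (c / theta) (dn 2%N x))).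
  move=> h; apply: is_derive_eq h _.
  rewrite /GRing.scale/= !expr1 !expr0; field.
  by rewrite gt_eqF.
have cf : continuous (fun x => (a + b * x + c * x ^+ 2) * expR (- theta * x)).
  have -> : (fun x => (a + b * x + c * x ^+ 2) * expR (- theta * x)) =
      (fun x => a * (x ^+ 0 * expR (- theta * x)) + b * (x ^+ 1 * expR (- theta * x))
       + c * (x ^+ 2 * expR (- theta * x))).
    by apply/funext => x; rewrite expr0 expr1; ring.
  have cn n : continuous (fun y : R => y ^+ n * expR (- theta * y)).
    move=> x; apply: differentiable_continuous.
    by apply/derivable1_diffP; exact: (@ex_derive _ _ _ _ _ _ _ (dn n x)).
  by move=> x; apply: cvgD; [apply: cvgD|]; apply: cvgMl_tmp; exact: cn.
rewrite (@ge0_continuous_FTC2y _ _ F _ 0)//.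
- rewrite /F !mulr0 expR0 sub0e; congr EFin; ring.
- by move=> x x0; rewrite mulr_ge0 ?expR_ge0// !addr_ge0// mulr_ge0// exprn_ge0.
- exact: continuous_subspaceT.
- rewrite -oppr0 /F; apply: cvgN.
  rewrite (_ : 0 = (a / theta + b / theta ^+ 2 + 2 * c / theta ^+ 3) * 0
     + (b / theta + 2 * c / theta ^+ 2) * 0 + c / theta * 0); last by ring.
  by apply: cvgD; [apply: cvgD|]; apply: cvgMl_tmp; exact: cvg_pow_expRN.
- apply: cvg_at_right_filter; apply: differentiable_continuous.
  by apply/derivable1_diffP; exact: (@ex_derive _ _ _ _ _ _ _ (dF 0)).
- by move=> x _; rewrite derive1E; exact: (@derive_val _ _ _ _ _ _ _ (dF x)).
Qed.
End exponential_moments.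

(** * The exponential law and its memorylessness *)

Section exponential_law.
Local Open Scope ereal_scope.
Context {R : realType}.
Local Notation leb := (@lebesgue_measure R).
Variables (rate : R) (nu : probability R R).
Hypothesis rate_gt0 : (0 < rate)%R.
Hypothesis nuE : forall B, measurable B -> nu B = exponential_prob rate B.

(** The law is only assumed to agree with the exponential one on measurable
    sets, so that the result applies directly to the distribution of a service
    or interarrival time. *)
Lemma integral_exponential_law (f : R -> \bar R) :
  measurable_fun setT f -> (forall x, 0 <= f x) ->
  \int[nu]_x f x =
  \int[leb]_(x in `[0%R, +oo[) (f x * (rate * expR (- rate * x))%:E).
Proof.
move=> mf f0.
(* The Lebesgue measure lives on another structure on the same sets, hence the
   transport along the identity. *)
have mid : measurable_fun setT (idfun : R -> measurableTypeR R).
  by move=> _ B mB; rewrite setTI.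
transitivity (\int[pushforward nu (idfun : R -> measurableTypeR R)]_x f x).
  by rewrite ge0_integral_pushforward.
rewrite (@ge0_integral_density _ _ _ leb _ (exponential_pdf rate))//; last 2 first.
- exact: measurable_exponential_pdf.
- by move=> x; apply: exponential_pdf_ge0; exact: ltW.
rewrite [RHS]integral_mkcond; apply: eq_integral => x _.
rewrite patchE; case: ifPn => [|x0].
  by rewrite inE/= in_itv/= andbT => x0; rewrite exponential_pdfE.
by rewrite /exponential_pdf patchE (negbTE x0) mule0.
Qed.

(** Since 0 is not an atom, ties between two exponential times may be ignored in
    all the pointwise computations below. *)
Lemma eq_exponential_law (f g : R -> \bar R) :
  measurable_fun setT f -> (forall x, 0 <= f x) ->
  measurable_fun setT g -> (forall x, 0 <= g x) ->
  (forall x, (0 < x)%R -> f x = g x) -> \int[nu]_x f x = \int[nu]_x g x.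
Proof.
move=> mf f0 mg g0 fg; rewrite !integral_exponential_law//.
have mp : measurable_fun setT (fun x : R => (rate * expR (- rate * x))%:E).
  apply/measurable_EFinP; apply: measurable_funM => //.
  by apply: measurableT_comp => //; exact: measurable_funM.
rewrite -[LHS]integral_itv_obnd_cbnd; last first.
  by apply: measurable_funTS; exact: emeasurable_funM.
rewrite -[RHS]integral_itv_obnd_cbnd; last first.
  by apply: measurable_funTS; exact: emeasurable_funM.
by apply: eq_integral => x; rewrite inE/= in_itv/= andbT => /fg ->.
Qed.

(** The factor [exp (- theta * x)] merely turns the rate into [theta + rate]. *)
Lemma exponential_law_poly2 (theta a b c : R) (f : R -> \bar R) :
  (0 <= theta)%R -> (0 <= a)%R -> (0 <= b)%R -> (0 <= c)%R ->
  measurable_fun setT f -> (forall x, 0 <= f x) ->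
  (forall x, (0 <= x)%R ->
    f x = ((a + b * x + c * x ^+ 2) * expR (- theta * x))%:E) ->
  \int[nu]_x f x = (rate * (a / (theta + rate) + b / (theta + rate) ^+ 2
                            + 2 * c / (theta + rate) ^+ 3))%:E.
Proof.
move=> t0 a0 b0 c0 mf f0 fE; rewrite integral_exponential_law//.
have tr0 : (0 < theta + rate)%R by rewrite ltr_wpDl.
transitivity (\int[leb]_(x in `[0%R, +oo[)
    ((rate * a + rate * b * x + rate * c * x ^+ 2)
      * expR (- (theta + rate) * x))%:E).
  apply: eq_integral => x; rewrite inE/= in_itv/= andbT => /fE ->.
  rewrite -EFinM; congr EFin.
  rewrite (_ : - (theta + rate) * x = - theta * x + - rate * x)%R; last by ring.
  by rewrite expRD; ring.
rewrite integral_poly2_expRN ?mulr_ge0 ?(ltW rate_gt0)//; congr EFin.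
by field; rewrite gt_eqF.
Qed.

(** Beyond [g] the density is [exp (- rate * g)] times its own translate by
    [g]. *)
Lemma exponential_law_memoryless (g : R) (f : R -> \bar R) : (0 <= g)%R ->
  measurable_fun setT f -> (forall x, 0 <= f x) ->
  (forall x, (0 <= x < g)%R -> f x = 0) ->
  \int[nu]_x f x = (expR (- rate * g))%:E * \int[nu]_x f (x + g)%R.
Proof.
move=> g0 mf f0 fg.
have mfg : measurable_fun setT (fun x : R => f (x + g)%R).
  by apply: measurableT_comp => //; exact: measurable_funD.
have mp : measurable_fun setT (fun x : R => (rate * expR (- rate * x))%:E).
  apply/measurable_EFinP; apply: measurable_funM => //.
  by apply: measurableT_comp => //; exact: measurable_funM.
have p0 (x : R) : 0 <= (rate * expR (- rate * x))%:E.
  by rewrite lee_fin mulr_ge0 ?expR_ge0// ltW.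
rewrite !integral_exponential_law//.
transitivity (\int[leb]_(x in `[g, +oo[) (f x * (rate * expR (- rate * x))%:E)).
  rewrite [LHS]integral_mkcond [RHS]integral_mkcond; apply: eq_integral => x _.
  rewrite !patchE !mem_setE !in_itv/= !andbT.
  case: ifPn => x0; case: ifPn => xg //.
  - by rewrite fg ?mul0e// x0 ltNge.
  - by rewrite (le_trans g0 xg) in x0.
rewrite ge0_integral_shift//; last 2 first.
- exact: emeasurable_funM.
- by move=> x; rewrite mule_ge0.
rewrite -ge0_integralZl//; last 2 first.
- by apply: measurable_funTS; exact: emeasurable_funM.
- by move=> x _; rewrite mule_ge0.
apply: eq_integral => x _; rewrite muleCA; congr (_ * _).
by rewrite -EFinM; congr EFin; rewrite mulrDr expRD; ring.
Qed.

End exponential_law.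

(** * Races between two exponential clocks *)

Section exponential_race.
Local Open Scope ereal_scope.
Context {R : realType}.
Variables (rate : R) (nu : probability R R).
Hypothesis rate_gt0 : (0 < rate)%R.
Hypothesis nuE : forall B, measurable B -> nu B = exponential_prob rate B.

(** Say that [x] is the smaller time: it survives the other clock with
    probability [exp (- rate * x)], and the excess [y - x] is then a fresh
    exponential time, independent of [x].  Either clock may ring first, whence
    the factor 2. *)
Lemma exponential_race (u v : R -> R) :
  measurable_fun setT u -> measurable_fun setT v ->
  (forall x, 0 <= u x)%R -> (forall x, 0 <= v x)%R ->
  \int[nu]_x \int[nu]_y (u (Num.min x y) * v `|x - y|)%:E =
  2%:E * (\int[nu]_x (u x * expR (- rate * x))%:E * \int[nu]_d (v d)%:E).
Proof.
move=> mu mv u0 v0.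
have mm : measurable_fun setT (fun z : R * R => u (Num.min z.1 z.2)).
  by apply: measurableT_comp => //; exact: measurable_minr.
have mn : measurable_fun setT (fun z : R * R => v `|z.1 - z.2|%R).
  apply: measurableT_comp => //; apply: measurableT_comp => //.
  exact: measurable_funB.
pose f (z : R * R) := (u (Num.min z.1 z.2) * v `|z.1 - z.2|)%:E.
have f0 z : 0 <= f z by rewrite lee_fin mulr_ge0.
have mf : measurable_fun setT f by apply/measurable_EFinP; exact: measurable_funM.
pose f1 z := if (z.1 <= z.2)%R then f z else 0.
pose f2 z := if (z.1 <= z.2)%R then 0 else f z.
have f10 z : 0 <= f1 z by rewrite /f1; case: ifP.
have f20 z : 0 <= f2 z by rewrite /f2; case: ifP.
have mf1 : measurable_fun setT f1.
  by apply: measurable_fun_ifT => //; exact: measurable_fun_ler.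
have mf2 : measurable_fun setT f2.
  by apply: measurable_fun_ifT => //; exact: measurable_fun_ler.
have fE z : f z = f1 z + f2 z.
  by rewrite /f1 /f2; case: ifP; rewrite ?adde0 ?add0e.
have me : measurable_fun setT (fun x : R => expR (- rate * x)).
  by apply: measurableT_comp => //; exact: measurable_funM.
pose I := \int[nu]_x (u x * expR (- rate * x))%:E.
pose J := \int[nu]_d (v d)%:E.
have J0 : 0 <= J by apply: integral_ge0 => d _; rewrite lee_fin.
(* The contribution of one of the two orders, with the winner integrated
   outside and memorylessness applied to the loser. *)
have half (h : R * R -> \bar R) : measurable_fun setT h -> (forall z, 0 <= h z) ->
    (forall x y, (y < x)%R -> h (x, y) = 0) ->
    (forall x d, (0 < d)%R -> h (x, x + d)%R = (u x * v d)%:E) ->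
    \int[nu]_x \int[nu]_y h (x, y) = I * J.
  move=> mh h0 hlt hge.
  transitivity (\int[nu]_x ((u x * expR (- rate * x))%:E * J)).
    apply: (eq_exponential_law rate_gt0 nuE) => //.
    - exact: (measurable_fun_fubini_tonelli_F h).
    - by move=> x; exact: integral_ge0.
    - apply: emeasurable_funM => //; apply/measurable_EFinP.
      exact: measurable_funM.
    - by move=> x; rewrite mule_ge0// lee_fin mulr_ge0// expR_ge0.
    move=> x x0.
    have mhx : measurable_fun setT (fun y => h (x, y)) by exact: measurableT_comp.
    rewrite (exponential_law_memoryless rate_gt0 nuE (ltW x0))//; last first.
      by move=> y /andP[_ yx]; exact: hlt.
    rewrite [X in _ * X](_ : _ = (u x)%:E * J).
      by rewrite muleA -EFinM [(expR _ * _)%R]mulrC.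
    rewrite -ge0_integralZl//; last 3 first.
    - exact/measurable_EFinP.
    - by move=> d _; rewrite lee_fin.
    - by rewrite lee_fin.
    apply: (eq_exponential_law rate_gt0 nuE) => //.
    - apply: (measurableT_comp mhx); exact: measurable_funD.
    - by apply: emeasurable_funM => //; exact/measurable_EFinP.
    - by move=> d; rewrite mule_ge0// lee_fin.
    - by move=> d d0; rewrite addrC hge// EFinM.
  rewrite ge0_integralZr//.
  - by apply/measurable_EFinP; exact: measurable_funM.
  - by move=> x _; rewrite lee_fin mulr_ge0// expR_ge0.
transitivity (\int[nu]_x (\int[nu]_y f1 (x, y) + \int[nu]_y f2 (x, y))).
  apply: eq_integral => x _.
  rewrite -ge0_integralD//; last 2 first.
  - by apply: measurableT_comp.
  - by apply: measurableT_comp.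
  by apply: eq_integral => y _; rewrite -fE.
rewrite ge0_integralD//; last 4 first.
- by move=> x _; exact: integral_ge0.
- exact: measurable_fun_fubini_tonelli_F.
- by move=> x _; exact: integral_ge0.
- exact: measurable_fun_fubini_tonelli_F.
rewrite half//; last 2 first.
- by move=> x y yx; rewrite /f1/= leNgt yx.
- move=> x d d0; rewrite /f1/f/= lerDl ltW// minEle lerDl ltW//.
  by rewrite opprD addrA subrr sub0r normrN gtr0_norm.
rewrite (fubini_tonelli f2)// (half (fun z => f2 (z.2, z.1)))//; last 3 first.
- by apply: measurableT_comp => //; exact: measurable_fun_pair.
- by move=> x y yx; rewrite /f2/= ltW.
- move=> x d d0; rewrite /f2/f/= leNgt ltrDl d0/=.
  by rewrite minC minEle lerDl ltW// [(x + d)%R]addrC addrK gtr0_norm.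
have IJ0 : 0 <= I * J.
  by rewrite mule_ge0//; apply: integral_ge0 => x _;
    rewrite lee_fin mulr_ge0// expR_ge0.
by rewrite -mule2n mule_natl.
Qed.

(** If nothing happens unless the first clock outlasts [g], then at time [g] the
    two clocks race afresh. *)
Lemma exponential_race_after (g : R) (f : R -> R -> R) (u v : R -> R) :
  (0 <= g)%R ->
  measurable_fun setT (fun z : R * R => f z.1 z.2) ->
  (forall x y, 0 <= f x y)%R ->
  measurable_fun setT u -> measurable_fun setT v ->
  (forall x, 0 <= u x)%R -> (forall x, 0 <= v x)%R ->
  (forall x y, (0 <= x < g)%R -> (0 < y)%R -> f x y = 0%R) ->
  (forall x y, (0 < x)%R -> (0 < y)%R ->
     f (x + g)%R y = (u (Num.min x y) * v `|x - y|)%R) ->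
  \int[nu]_x \int[nu]_y (f x y)%:E =
  (expR (- rate * g))%:E *
    (2%:E * (\int[nu]_x (u x * expR (- rate * x))%:E * \int[nu]_d (v d)%:E)).
Proof.
move=> g0 mf f0 mu mv u0 v0 flt fge.
pose F z : \bar R := (f z.1 z.2)%:E.
have mF : measurable_fun setT F by exact/measurable_EFinP.
have F0 z : 0 <= F z by rewrite lee_fin.
rewrite -exponential_race//.
rewrite (fubini_tonelli F)//.
have mm : measurable_fun setT (fun z : R * R => u (Num.min z.1 z.2)).
  by apply: measurableT_comp => //; exact: measurable_minr.
have mn : measurable_fun setT (fun z : R * R => v `|z.1 - z.2|%R).
  apply: measurableT_comp => //; apply: measurableT_comp => //.
  exact: measurable_funB.
pose H (z : R * R) := (u (Num.min z.1 z.2) * v `|z.1 - z.2|)%:E.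
have H0 z : 0 <= H z by rewrite lee_fin mulr_ge0.
have mH : measurable_fun setT H by apply/measurable_EFinP; exact: measurable_funM.
rewrite (fubini_tonelli H)// -ge0_integralZl//; last 2 first.
- exact: (measurable_fun_fubini_tonelli_G H).
- by move=> x _; exact: integral_ge0.
have mFg : measurable_fun setT (fun z : R * R => F (z.1 + g, z.2)%R).
  apply: measurableT_comp => //; apply: measurable_fun_pair => //.
  exact: measurable_funD.
have mHy y : measurable_fun setT (fun x => H (x, y)) by exact: measurableT_comp.
have mFy y : measurable_fun setT (fun x => F (x, y)) by exact: measurableT_comp.
apply: (eq_exponential_law rate_gt0 nuE) => //.
- exact: measurable_fun_fubini_tonelli_G.
- by move=> x; exact: integral_ge0.
- apply: emeasurable_funM => //; exact: measurable_fun_fubini_tonelli_G.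
- by move=> y; rewrite mule_ge0 ?lee_fin ?expR_ge0//; exact: integral_ge0.
move=> y y0.
rewrite (exponential_law_memoryless rate_gt0 nuE g0)//; last first.
  by move=> x xg; rewrite /F/= flt.
congr (_ * _); apply: (eq_exponential_law rate_gt0 nuE) => //.
- by apply: (measurableT_comp (mFy y)); exact: measurable_funD.
- by move=> x x0; rewrite /F /H/= fge.
Qed.
End exponential_race.

(** * Overlaps in a station entered with a given time lag *)

(** Time is counted from the arrival of the first customer; [delta], of any
    sign, is the arrival time of the second one, and [x], [y] are their
    services. *)
Definition station_overlap {R : realType} (delta x y : R) : R :=
  Num.max (Num.min x (delta + y) - Num.max 0 delta) 0.

Section station_overlap.
Context {R : realType}.

Lemma station_overlap_ge0 (delta x y : R) : 0 <= station_overlap delta x y.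
Proof. by rewrite /station_overlap le_max lexx orbT. Qed.

Lemma station_overlapE (a b x y : R) :
  Num.max (Num.min (a + x) (b + y) - Num.max a b) 0 = station_overlap (b - a) x y.
Proof.
rewrite /station_overlap !minEle !maxEle.
by repeat case: ifPn; rewrite -?ltNge; move=> *; lra.
Qed.

(** Exchanging the customers reverses the time lag. *)
Lemma station_overlapN (delta x y : R) :
  station_overlap delta x y = station_overlap (- delta) y x.
Proof.
rewrite /station_overlap !minEle !maxEle.
by repeat case: ifPn; rewrite -?ltNge; move=> *; lra.
Qed.

Lemma station_overlap_before (delta x y : R) : x < delta ->
  station_overlap delta x y = 0.
Proof.
rewrite /station_overlap !minEle !maxEle => ?.
by repeat case: ifPn; rewrite -?ltNge; move=> *; lra.
Qed.

Lemma station_overlap_after (delta x y : R) : 0 <= delta -> 0 < x -> 0 < y ->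
  station_overlap delta (x + delta) y = Num.min x y.
Proof.
rewrite /station_overlap !minEle !maxEle => *.
by repeat case: ifPn; rewrite -?ltNge; move=> *; lra.
Qed.

Lemma measurable_station_overlap d (T : measurableType d) (f g h : T -> R) :
  measurable_fun setT f -> measurable_fun setT g -> measurable_fun setT h ->
  measurable_fun setT (fun w => station_overlap (f w) (g w) (h w)).
Proof.
move=> mf mg mh; apply: measurable_maxr => //; apply: measurable_funB.
  by apply: measurable_minr => //; exact: measurable_funD.
exact: measurable_maxr.
Qed.
End station_overlap.

Section overlap_moments.
Local Open Scope ereal_scope.
Context {R : realType}.
Variables (rate : R) (nu : probability R R).
Hypothesis rate_gt0 : (0 < rate)%R.
Hypothesis nuE : forall B, measurable B -> nu B = exponential_prob rate B.

Let r0 : rate != 0%R. Proof. by rewrite gt_eqF. Qed.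

Let rr0 : (rate + rate != 0)%R. Proof. by rewrite gt_eqF// addr_gt0. Qed.

Let integral_maxr_pow (p : nat) : (p <= 2)%N ->
  \int[nu]_x (Num.max x 0 ^+ p * expR (- rate * x))%:E =
  (p`!%:R / (2 ^+ p.+1 * rate ^+ p))%:E.
Proof.
move=> p2.
rewrite (@exponential_law_poly2 _ rate nu rate_gt0 nuE rate
  (p == 0%N)%:R (p == 1%N)%:R (p == 2%N)%:R)//;
  rewrite ?ltW ?ler0n//.
- congr EFin.
  by case: p p2 => [|[|[|]]]//= _; rewrite ?factS fact0 ?muln1; field; rewrite ?rr0 ?r0.
- apply/measurable_EFinP; apply: measurable_funM => //.
    by apply: measurable_funX; exact: measurable_maxr.
  by apply: measurableT_comp => //; exact: measurable_funM.
- by move=> x; rewrite lee_fin mulr_ge0 ?expR_ge0// exprn_ge0// le_max lexx orbT.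
- move=> x x0; congr (_ * _)%:E; rewrite max_l//.
  by case: p p2 => [|[|[|]]]//= _; rewrite ?expr0 ?expr1; ring.
Qed.

Let integral_expRN : \int[nu]_d (expR (- rate * `|d|))%:E = (2^-1)%:E.
Proof.
rewrite (@exponential_law_poly2 _ rate nu rate_gt0 nuE rate 1 0 0)//; rewrite ?ltW//.
- congr EFin.
  by field; rewrite ?rr0 ?r0.
- apply/measurable_EFinP.
  by do 2 apply: measurableT_comp => //; exact: measurableT_comp.
- by move=> x x0; rewrite ger0_norm//; congr EFin; ring.
Qed.

Let mov2 (delta : R) : measurable_fun setT
  (fun z : R * R => station_overlap delta z.1 z.2).
Proof. exact: measurable_station_overlap. Qed.

(** After the later arrival the overlap is the minimum in a race between two
    fresh clocks.  The case [p = 0] differs, because of the event that the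
    customers do not meet. *)
Lemma station_overlap_moment (p : nat) (delta : R) : (0 < p <= 2)%N ->
  \int[nu]_x \int[nu]_y (station_overlap delta x y ^+ p)%:E =
  (p`!%:R / (2 * rate) ^+ p * expR (- rate * `|delta|))%:E.
Proof.
move=> /andP[p0 p2].
wlog d0 : delta / (0 <= delta)%R => [h|].
  have [/h//|d0] := leP 0%R delta.
  have mF : measurable_fun setT
      (fun z : R * R => (station_overlap delta z.1 z.2 ^+ p)%:E).
    by apply/measurable_EFinP; exact: measurable_funX.
  rewrite (fubini_tonelli _ mF)/=; last first.
    by move=> z; rewrite lee_fin exprn_ge0// station_overlap_ge0.
  under eq_integral do under eq_integral do rewrite station_overlapN.
  by rewrite h ?normrN// oppr_ge0 ltW.
rewrite (@exponential_race_after _ rate nu rate_gt0 nuE delta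
  (fun x y => station_overlap delta x y ^+ p)%R
  (fun x => Num.max x 0 ^+ p)%R (fun=> 1%R))//.
- rewrite integral_maxr_pow// integral_cst//
    [X in 1 * X](_ : _ = 1) ?mule1 ?ger0_norm//;
    last exact: (@probability_setT _ _ _ nu).
  rewrite -!EFinM; congr EFin.
    by rewrite exprS exprMn; field; rewrite ?expf_neq0 ?r0.
- exact: measurable_funX.
- by move=> x y; rewrite exprn_ge0// station_overlap_ge0.
- by apply: measurable_funX; exact: measurable_maxr.
- by move=> x; rewrite exprn_ge0// le_max lexx orbT.
- by move=> x y /andP[_ xd] _; rewrite station_overlap_before// expr0n gtn_eqF.
- move=> x y x0 y0; rewrite station_overlap_after// mulr1 max_l//.
  by rewrite le_min !ltW.
Qed.

Let mnext (g : R) : measurable_fun setT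
  (fun z : R * R => expR (- rate * `|g + z.2 - z.1|))%R.
Proof.
apply: measurableT_comp => //; apply: measurable_funM => //.
apply: measurableT_comp => //; apply: measurable_funB => //.
exact: measurable_funD.
Qed.

(** Both factors are functions of the same race, started at the later arrival
    [g]: the overlap is its minimum, and the lag [g + y - x] at the next station
    is, up to sign, the difference of the clocks. *)
Lemma station_overlap_next (g : R) : (0 <= g)%R ->
  \int[nu]_x \int[nu]_y
    (station_overlap g x y * expR (- rate * `|g + y - x|))%:E =
  ((4 * rate)^-1 * expR (- rate * g))%:E.
Proof.
move=> g0.
rewrite (@exponential_race_after _ rate nu rate_gt0 nuE g
  (fun x y => station_overlap g x y * expR (- rate * `|g + y - x|))%R
  (fun x => Num.max x 0 ^+ 1)%R (fun d => expR (- rate * `|d|))%R)//.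
- rewrite integral_maxr_pow// integral_expRN.
  rewrite -!EFinM; congr EFin.
  by rewrite factS fact0 muln1; field; rewrite ?rr0 ?r0.
- exact: measurable_funM.
- by move=> x y; rewrite mulr_ge0 ?expR_ge0// station_overlap_ge0.
- by apply: measurable_funX; exact: measurable_maxr.
- by apply: measurableT_comp => //; apply: measurable_funM => //;
    exact: measurableT_comp.
- by move=> x; rewrite exprn_ge0// le_max lexx orbT.
- by move=> x y /andP[_ xd] _; rewrite station_overlap_before// mul0r.
- move=> x y x0 y0; rewrite station_overlap_after// max_l ?expr1; last first.
    by rewrite le_min !ltW.
  by rewrite (_ : g + y - (x + g) = y - x)%R 1?distrC ?normr_id//; ring.
Qed.

(** If the first customer stays beyond [g], the lag at the next station is the
    difference in a fresh race.  If he leaves at [x < g], it is [g - x + y], and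
    integrating [exp (- rate * (g - x))] against the exponential density
    between 0 and [g] gives [rate * g * exp (- rate * g)]. *)
Lemma expRN_next_gap (g : R) : (0 <= g)%R ->
  \int[nu]_x \int[nu]_y (expR (- rate * `|g + y - x|))%:E =
  ((2^-1 + rate / 2 * g) * expR (- rate * g))%:E.
Proof.
move=> g0.
(* [f1]: the first customer has already left; [f2]: he is still present. *)
pose f1 (z : R * R) := (if z.1 < g then expR (- rate * `|g + z.2 - z.1|) else 0)%R.
pose f2 (z : R * R) := (if z.1 < g then 0 else expR (- rate * `|g + z.2 - z.1|))%R.
have mf1 : measurable_fun setT f1.
  by apply: measurable_fun_ifT => //; exact: measurable_fun_ltr.
have mf2 : measurable_fun setT f2.
  by apply: measurable_fun_ifT => //; exact: measurable_fun_ltr.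
have f10 z : (0 <= f1 z)%R by rewrite /f1; case: ifP => // _; rewrite expR_ge0.
have f20 z : (0 <= f2 z)%R by rewrite /f2; case: ifP => // _; rewrite expR_ge0.
have me1 : measurable_fun setT (EFin \o f1) by exact/measurable_EFinP.
have me2 : measurable_fun setT (EFin \o f2) by exact/measurable_EFinP.
transitivity (\int[nu]_x (\int[nu]_y (EFin \o f1) (x, y) +
                          \int[nu]_y (EFin \o f2) (x, y))).
  apply: eq_integral => x _.
  rewrite -ge0_integralD//; last 4 first.
  - by move=> y _; rewrite lee_fin.
  - exact: (measurableT_comp me1).
  - by move=> y _; rewrite lee_fin.
  - exact: (measurableT_comp me2).
  apply: eq_integral => y _; rewrite /f1 /f2/=.
  by case: ifP => _; rewrite ?adde0 ?add0e.
rewrite ge0_integralD//; last 4 first.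
- by move=> x _; apply: integral_ge0 => y _; rewrite lee_fin.
- by apply: (measurable_fun_fubini_tonelli_F (EFin \o f1)) => // z; rewrite lee_fin.
- by move=> x _; apply: integral_ge0 => y _; rewrite lee_fin.
- by apply: (measurable_fun_fubini_tonelli_F (EFin \o f2)) => // z; rewrite lee_fin.
have -> : \int[nu]_x \int[nu]_y (EFin \o f2) (x, y) =
    (2^-1 * expR (- rate * g))%:E.
  rewrite (@exponential_race_after _ rate nu rate_gt0 nuE g
    (fun x y => f2 (x, y)) (fun x => Num.max x 0 ^+ 0)%R
    (fun d => expR (- rate * `|d|))%R)//.
  - rewrite integral_maxr_pow// integral_expRN -!EFinM fact0; congr EFin.
    by field; rewrite ?rr0 ?r0.
  - by apply: measurableT_comp => //; apply: measurable_funM => //;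
    exact: measurableT_comp.
  - by move=> x y /andP[_ xg] _; rewrite /f2/= xg.
  - move=> x y x0 y0; rewrite /f2/= ltNge lerDr ltW//= expr0 mul1r.
    by rewrite (_ : g + y - (x + g) = y - x)%R 1?distrC ?normr_id//; ring.
rewrite (fubini_tonelli (EFin \o f1))//.
rewrite (@exponential_law_poly2 _ rate nu rate_gt0 nuE rate
  (rate * g * expR (- rate * g)) 0 0)//;
  rewrite ?mulr_ge0 ?expR_ge0// ?(ltW rate_gt0)//.
- by rewrite -EFinD; congr EFin; field; rewrite ?rr0 ?r0.
- by apply: (measurable_fun_fubini_tonelli_G (EFin \o f1)) => // z; rewrite lee_fin.
- by move=> x; apply: integral_ge0 => y _; rewrite lee_fin.
move=> y y0; rewrite (integral_exponential_law rate_gt0 nuE)//; last 2 first.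
- exact: (measurableT_comp me1).
- by move=> x; rewrite lee_fin.
transitivity (\int[@lebesgue_measure R]_(x in `[0%R, g[)
    (cst ((rate * expR (- rate * g) * expR (- rate * y))%:E)) x).
  rewrite [LHS]integral_mkcond [RHS]integral_mkcond; apply: eq_integral => x _.
  rewrite !patchE !mem_setE !in_itv/= andbT /f1/=.
  case: ifPn => //= x0; case: ifPn => xg; last by rewrite mul0e.
  rewrite -EFinM; congr EFin; rewrite ger0_norm; last by lra.
  rewrite mulrCA -expRD -mulrA -expRD; congr (_ * expR _)%R; ring.
rewrite integral_cst//= lebesgue_measure_itv/= lte_fin.
move: g0; rewrite le_eqVlt => /predU1P[<-|g0].
  by rewrite ltxx mule0; congr EFin; ring.
by rewrite g0 -EFinB -EFinM; congr EFin; ring.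
Qed.

End overlap_moments.

(** * Pairs of independent random variables *)

Section paired_random_variables.
Context d d1 d2 (T : measurableType d) (T1 : measurableType d1)
  (T2 : measurableType d2) (R : realType) (P : probability T R).

Definition pairRV (V : {RV P >-> T1}) (X : {RV P >-> T2}) (w : T) : T1 * T2 :=
  (V w, X w).

Variables (V : {RV P >-> T1}) (X : {RV P >-> T2}).

Let measurable_pairRV : measurable_fun setT (pairRV V X).
Proof. exact: measurable_fun_pair. Qed.

HB.instance Definition _ :=
  isMeasurableFun.Build _ _ _ _ (pairRV V X) measurable_pairRV.
End paired_random_variables.

Section independence.
Local Open Scope ereal_scope.
Context d (T : measurableType d) (R : realType) (P : probability T R).

(** Only the events of a class are tested, not those of the sigma-algebra it
    generates: for a class of cylinders this is what a product formula gives. *)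
Definition independent_of d' (T' : measurableType d') (Ev : set (set T))
    (V : T -> T') :=
  forall E C, Ev E -> measurable C ->
    P (E `&` V @^-1` C) = P E * P (V @^-1` C).

Context d1 d2 (T1 : measurableType d1) (T2 : measurableType d2).
Variables (V : {RV P >-> T1}) (X : {RV P >-> T2}).

Lemma joint_law_product :
  (forall A B, measurable A -> measurable B ->
    P (V @^-1` A `&` X @^-1` B) = P (V @^-1` A) * P (X @^-1` B)) ->
  forall C, measurable C ->
    (distribution P V \x distribution P X) C = P (pairRV V X @^-1` C).
Proof.
move=> VX C mC.
by apply: (@product_measure_unique _ _ _ _ _ (distribution P V)
  (distribution P X) (distribution P (pairRV V X : {RV P >-> (T1 * T2)%type}))).
Qed.

Lemma integral_independent_pair (f : T1 * T2 -> \bar R) :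
  (forall A B, measurable A -> measurable B ->
    P (V @^-1` A `&` X @^-1` B) = P (V @^-1` A) * P (X @^-1` B)) ->
  measurable_fun setT f -> (forall z, 0 <= f z) ->
  \int[P]_w f (V w, X w) = \int[P]_w \int[distribution P X]_x f (V w, x).
Proof.
move=> VX mf f0.
transitivity (\int[distribution P (pairRV V X : {RV P >-> (T1 * T2)%type})]_z f z).
  by rewrite ge0_integral_distribution.
transitivity (\int[distribution P V \x distribution P X]_z f z).
  apply: eq_measure_integral => C mC _; apply/esym; exact: joint_law_product.
rewrite fubini_tonelli1// ge0_integral_distribution//.
- exact: measurable_fun_fubini_tonelli_F.
- by move=> v; exact: integral_ge0.
Qed.

(** Conditionally on an event of [Ev], the law of [(V, X)] takes the same values
    on rectangles as its unconditional law, and rectangles determine it. *)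
Lemma independent_of_pair (Ev : set (set T)) :
  Ev `<=` measurable -> Ev setT -> independent_of Ev X ->
  independent_of [set E `&` X @^-1` B | E in Ev & B in measurable] V ->
  independent_of Ev (pairRV V X).
Proof.
move=> mEv EvT indX indV E C EvE mC.
have VX A B : measurable A -> measurable B ->
    P (V @^-1` A `&` X @^-1` B) = P (V @^-1` A) * P (X @^-1` B).
  move=> mA mB; rewrite setIC -[X @^-1` B]setTI indV//; last first.
    by exists setT => //; exists B.
  by rewrite setTI muleC.
have mE := mEv _ EvE.
(* A null event cannot be conditioned on, but both sides are then 0. *)
have [PE0|PE0] := eqVneq (P E) 0.
  rewrite PE0 mul0e; apply: (subset_measure0 (B := E)) => //.
  by apply: measurableI => //; exact: measurable_funPTI.
pose c := fine (P E).
have PEc : P E = c%:E by rewrite fineK// fin_num_measure.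
have c0 : (0 < c)%R by rewrite -lte_fin -PEc lt0e PE0 measure_ge0.
have ci0 : (0 <= c^-1)%R by rewrite invr_ge0 ltW.
have mVX : measurable_fun setT (pairRV V X) by exact: measurable_fun_pair.
pose restricted : {measure set (T1 * T2) -> \bar R} :=
  pushforward (mrestr P mE) (pairRV V X : {RV P >-> (T1 * T2)%type}).
(* The law of [(V, X)] given [E]. *)
pose conditional : {measure set (T1 * T2) -> \bar R} :=
  mscale (NngNum ci0) (restricted mVX).
have conditionalE B : conditional B = c^-1%:E * P (pairRV V X @^-1` B `&` E).
  by [].
have := @product_measure_unique _ _ _ _ _ (distribution P V)
  (distribution P X) conditional _ _ mC.
rewrite joint_law_product// conditionalE setIC => ->.
  by rewrite muleA PEc -EFinM divff ?gt_eqF// mul1e.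
move=> A B mA mB; rewrite conditionalE.
have -> : pairRV V X @^-1` (A `*` B) `&` E = (E `&` X @^-1` B) `&` V @^-1` A.
  by apply/seteqP; split => w /=; tauto.
rewrite indV//; last by exists E => //; exists B.
rewrite indX// PEc !muleA -EFinM mulVf ?gt_eqF// mul1e.
by rewrite muleC.
Qed.
End independence.

(** * Cylinder events of a mutually independent family *)

Section cylinders.
Local Open Scope ereal_scope.
Context d (T : measurableType d) (R : realType) (P : probability T R).
Context (I : choiceType) (D : set I) (X : I -> {RV P >-> R}).

Definition cylinders (J : {fset I}) : set (set T) :=
  [set E | exists2 B : I -> set R, (forall i, i \in J -> measurable (B i)) &
             E = \bigcap_(i in [set` J]) X i @^-1` B i].

Lemma cylinders_measurable J : cylinders J `<=` measurable.
Proof.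
move=> _ [B mB ->]; apply: fin_bigcap_measurable => // i iJ.
by apply: measurable_funPTI => //; exact: mB.
Qed.

Lemma cylindersT J : cylinders J setT.
Proof.
by exists (fun=> setT) => //; apply/seteqP; split.
Qed.

Let bigcap_fsetU1 i (J : {fset I}) (B : I -> set R) (C : set R) :
  i \notin J ->
  (\bigcap_(j in [set` J]) X j @^-1` B j) `&` X i @^-1` C =
  \bigcap_(j in [set` (i |` J)%fset])
     X j @^-1` (if j == i then C else B j).
Proof.
move=> iJ; rewrite set_fsetU1 bigcap_setU1 eqxx setIC; congr (_ `&` _).
apply: eq_bigcapr => j /= jJ; case: eqVneq => // ji.
by rewrite ji (negbTE iJ) in jJ.
Qed.

Let measurable_fsetU1 i (J : {fset I}) (B : I -> set R) (C : set R) :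
  (forall j, j \in J -> measurable (B j)) -> measurable C ->
  forall j, j \in (i |` J)%fset -> measurable (if j == i then C else B j).
Proof. by move=> mB mC j; rewrite !inE; case: eqVneq => //= _ /mB. Qed.

Lemma cylindersU1 i J E B : i \notin J -> cylinders J E -> measurable B ->
  cylinders (i |` J)%fset (E `&` X i @^-1` B).
Proof.
move=> iJ [C mC ->] mB; exists (fun j => if j == i then B else C j).
  exact: measurable_fsetU1.
exact: bigcap_fsetU1.
Qed.

Hypothesis mutX : mutually_independent D X.

Lemma independent_of_cylinders i (J : {fset I}) :
  [set` (i |` J)%fset] `<=` D -> i \notin J ->
  independent_of P (cylinders J) (X i).
Proof.
move=> iJD iJ _ C [B mB ->] mC.
rewrite bigcap_fsetU1// mutX//; last exact: measurable_fsetU1.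
rewrite mutX//; last by move=> j /= jJ; apply: iJD; rewrite /= !inE jJ orbT.
rewrite big_fsetU1//= eqxx muleC; congr (_ * _).
apply: eq_big_seq => j jJ; case: eqVneq => // ji.
by rewrite ji (negbTE iJ) in jJ.
Qed.

(** The step that adjoins the coordinate [i] to [V]: it is taken out of the
    coordinates from which [V] is independent. *)
Lemma independent_of_cylinders_pair d' (T' : measurableType d')
    (V : {RV P >-> T'}) i (J : {fset I}) :
  [set` (i |` J)%fset] `<=` D -> i \notin J ->
  independent_of P (cylinders (i |` J)%fset) V ->
  independent_of P (cylinders J) (pairRV V (X i)).
Proof.
move=> iJD iJ indV; apply: independent_of_pair.
- exact: cylinders_measurable.
- exact: cylindersT.
- exact: independent_of_cylinders.
- move=> _ C [E JE [B mB <-]] mC.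
  by apply: indV => //; exact: cylindersU1.
Qed.

Lemma integral_independent_cylinder d' (T' : measurableType d')
    (V : {RV P >-> T'}) i (f : T' * R -> \bar R) :
  independent_of P (cylinders [fset i]%fset) V ->
  measurable_fun setT f -> (forall z, 0 <= f z) ->
  \int[P]_w f (V w, X i w) = \int[P]_w \int[distribution P (X i)]_x f (V w, x).
Proof.
move=> indV mf f0; apply: integral_independent_pair => // A B mA mB.
rewrite setIC muleC indV//.
rewrite -[X i @^-1` B]setTI -[[fset i]%fset]fsetU0.
by apply: cylindersU1 => //; exact: cylindersT.
Qed.

End cylinders.

(** * Sums of interarrival times *)

Section interarrival_sums.
Local Open Scope ereal_scope.
Context d (T : measurableType d) (R : realType) (P : probability T R).
Variables (lambda : R) (A : nat -> {RV P >-> R}) (n : nat).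
Hypotheses (lambda_gt0 : (0 < lambda)%R) (n_ge1 : (1 <= n)%N).
Hypothesis poissonA : poisson_process_points lambda A.

Let gap k : {RV P >-> R} := (A (n + k) - A n)%R.

Let gapS k w : gap k.+1 w = (gap k w + interarrival A (n + k) w)%R.
Proof.
rewrite /gap /interarrival addnS;
  case: (n + k)%N (leq_trans n_ge1 (leq_addr k n)) => //= m _.
change (A m.+2 w - A n w = (A m.+1 w - A n w) + (A m.+2 w - A m.+1 w))%R; ring.
Qed.

(** The gap between the customers n and n + k only involves the interarrival
    times of index below n + k. *)
Lemma gap_independent k (J : {fset nat}) :
  (forall j, j \in J -> (n + k <= j)%N) ->
  independent_of P (cylinders (interarrival A) J) (gap k).
Proof.
have [mutA _] := poissonA.
elim: k J => [|k IH] J Jk E C JE mC.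
  have -> : gap 0 @^-1` C = if 0%R \in C then setT else set0.
    apply/seteqP; split => w; rewrite /gap/= addn0 subrr;
      case: ifPn; rewrite ?inE//= => /negP.
    by rewrite inE.
  by case: ifP => _; rewrite ?setIT ?probability_setT ?mule1//
    setI0 measure0 mule0.
have nkJ : (n + k)%N \notin J.
  by apply/negP => /Jk; rewrite addnS ltnn.
have ind : independent_of P (cylinders (interarrival A) J)
    (pairRV (gap k) (interarrival A (n + k))).
  apply: (independent_of_cylinders_pair (D := setT)) => //.
  apply: IH => j; rewrite !inE => /predU1P[->//|/Jk].
  by rewrite addnS => /ltnW.
have -> : gap k.+1 @^-1` C = pairRV (gap k) (interarrival A (n + k)) @^-1`
    ((fun z : R * R => z.1 + z.2)%R @^-1` C).
  by apply/funext => w; rewrite /preimage /mkset gapS.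
apply: ind => //; rewrite -[X in measurable X]setTI.
exact: measurable_funD.
Qed.

(** Averaging over one gap of rate lambda maps [(a + b * s) * exp (- mu * s)] to
    a function of [s] of the same form: the coefficients become
    [r * (a + b / (lambda + mu))] and [r * b], where [r] is
    [lambda / (lambda + mu)].  The form of [h] is only prescribed on the
    half-line because lags enter through their absolute value; it is preserved
    there since gaps are almost surely nonnegative. *)
Lemma integral_gap (mu a b : R) (h : R -> \bar R) k :
  (0 < mu)%R -> (0 <= a)%R -> (0 <= b)%R ->
  measurable_fun setT h -> (forall s, 0 <= h s) ->
  (forall s, (0 <= s)%R -> h s = ((a + b * s) * expR (- mu * s))%:E) ->
  \int[P]_w h (gap k w) = ((lambda / (lambda + mu)) ^+ k *
                           (a + b * k%:R / (lambda + mu)))%:E.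
Proof.
move=> mu0; have lm0 : (0 < lambda + mu)%R by rewrite addr_gt0.
elim: k a b h => [|k IH] a b h a0 b0 mh h0 hE.
  transitivity (\int[P]_w (cst a%:E) w).
    apply: eq_integral => w _; rewrite /gap addn0 /= subrr hE//.
    by rewrite !mulr0 expR0 addr0 mulr1.
  rewrite integral_cst// [X in _ * X](_ : _ = 1); last first.
    exact: (@probability_setT _ _ _ P).
  by rewrite mule1; congr EFin; rewrite !mulr0 expr0; ring.
under eq_integral do rewrite gapS.
have [_ lawA] := poissonA.
have mhD : measurable_fun setT (fun z : R * R => h (z.1 + z.2)%R).
  by apply: measurableT_comp => //; exact: measurable_funD.
rewrite (integral_independent_cylinder (X := interarrival A) (V := gap k)
  (i := (n + k)%N) (f := fun z => h (z.1 + z.2)%R))//; last first.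
  by apply: gap_independent => j; rewrite !inE => /eqP ->.
rewrite (IH (lambda / (lambda + mu) * (a + b / (lambda + mu)))%R
            (lambda / (lambda + mu) * b)%R
    (fun s => \int[distribution P (interarrival A (n + k))]_x h (s + x)%R))//.
- by congr EFin; rewrite exprS -natr1; field; rewrite gt_eqF.
- by rewrite mulr_ge0 ?addr_ge0 ?divr_ge0 ?(ltW lambda_gt0) ?(ltW lm0).
- by rewrite mulr_ge0 ?divr_ge0 ?(ltW lambda_gt0) ?(ltW lm0).
- exact: (@measurable_fun_fubini_tonelli_F _ _ R R R
    (distribution P (interarrival A (n + k))) (fun z => h (z.1 + z.2)%R)).
- by move=> s; exact: integral_ge0.
move=> s s0.
rewrite (@exponential_law_poly2 _ lambda
  (distribution P (interarrival A (n + k))) lambda_gt0 _ mu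
  ((a + b * s) * expR (- mu * s)) (b * expR (- mu * s)) 0)//.
- by congr EFin; rewrite [(mu + _)%R]addrC; field; rewrite gt_eqF.
- exact: lawA.
- exact: ltW.
- by rewrite mulr_ge0 ?expR_ge0// addr_ge0// mulr_ge0.
- by rewrite mulr_ge0 ?expR_ge0.
- by apply: measurableT_comp => //; exact: measurable_funD.
- move=> x x0; rewrite hE ?addr_ge0//; congr EFin.
  rewrite (_ : - mu * (s + x) = - mu * s + - mu * x)%R; last by ring.
  by rewrite expRD; ring.
Qed.

End interarrival_sums.

(** * Expectations of overlaps with independent service times *)

Section generated_events.
Context d (T : measurableType d) (R : realType) (P : probability T R).

Lemma generated_sigma_algebraD (I : Type) (D : set I) (X : I -> {RV P >-> R})
    (i j : I) (B : set R) : D i -> D j -> measurable B ->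
  generated_sigma_algebra D X ((X i - X j)%R @^-1` B).
Proof.
move=> Di Dj mB.
set G := \bigcup_(i in D) preimage_set_system setT (X i) measurable.
have mX l : D l -> measurable_fun setT (X l : g_sigma_algebraType G -> R).
  move=> Dl _ C mC; apply: sub_sigma_algebra.
  by exists l => //; exists C.
have mS : measurable_fun setT
    ((fun w => X i w - X j w) : g_sigma_algebraType G -> R).
  by apply: measurable_funB; exact: mX.
have := mS measurableT _ mB.
by rewrite setTI.
Qed.

Lemma cylinders_generated (I : choiceType) (D : set I) (X : I -> {RV P >-> R})
    (J : {fset I}) :
  [set` J] `<=` D -> cylinders X J `<=` generated_sigma_algebra D X.
Proof.
move=> JD _ [B mB ->].
set G := \bigcup_(i in D) preimage_set_system setT (X i) measurable.
apply: (@fin_bigcap_measurable _ (g_sigma_algebraType G)) => // i iJ.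
apply: sub_sigma_algebra; exists i; first exact: JD.
by exists (B i); [exact: mB|rewrite setTI].
Qed.
End generated_events.

Section overlap_expectations.
Local Open Scope ereal_scope.
Context d (T : measurableType d) (R : realType) (P : probability T R).
Context (I : choiceType) (D : set I) (X : I -> {RV P >-> R}) (mu : R).
Hypotheses (mu_gt0 : (0 < mu)%R) (expX : iid_exponential D mu X).

Context d' (T' : measurableType d') (V : {RV P >-> T'}) (i j : I).
Hypotheses (ij : i != j) (ijD : [set` [fset i; j]%fset] `<=` D).
Hypothesis indV : independent_of P (cylinders X [fset i; j]%fset) V.

(** Both services are integrated against the distribution of the first one,
    because the races are between two copies of the same law. *)
Lemma integral_independent_cylinder2 (f : T' * R * R -> \bar R) :
  measurable_fun setT f -> (forall z, 0 <= f z) ->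
  \int[P]_w f (V w, X i w, X j w) =
  \int[P]_w \int[distribution P (X i)]_x
              \int[distribution P (X i)]_y f (V w, x, y).
Proof.
move=> mf f0; have [mutX lawX] := expX.
have indVi : independent_of P (cylinders X [fset j]%fset) (pairRV V (X i)).
  by apply: (independent_of_cylinders_pair mutX) => //; rewrite inE.
have indV1 : independent_of P (cylinders X [fset i]%fset) V.
  move=> E C iE mC; apply: indV => //.
  have := cylindersU1 (i := j) (B := setT) _ iE.
  rewrite preimage_setT setIT fsetUC; apply => //.
  by rewrite inE eq_sym.
rewrite (integral_independent_cylinder (V := pairRV V (X i)) indVi mf f0)/=.
have Di : D i by apply: ijD; rewrite /= !inE eqxx.
have Dj : D j by apply: ijD; rewrite /= !inE eqxx orbT.
transitivity (\int[P]_w \int[distribution P (X i)]_y f (pairRV V (X i) w, y)).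
  apply: eq_integral => w _; apply: eq_measure_integral => B mB _.
  exact: (eq_trans (lawX j Dj B mB) (esym (lawX i Di B mB))).
exact: (integral_independent_cylinder (V := V)
  (f := fubini_F (distribution P (X i)) f) indV1
  (measurable_fun_fubini_tonelli_F _ mf f0)
  (fun z => integral_ge0 _ (fun y _ => f0 (z, y)))).
Qed.

(** The overlap depends on the past [V] of the queue through the time lag
    alone, so that its conditional moment can be substituted for it even in the
    presence of a weight [psi] depending on [V]. *)
Lemma integral_overlap (p : nat) (delta psi : T' -> R) : (0 < p <= 2)%N ->
  measurable_fun setT delta -> measurable_fun setT psi ->
  (forall v, 0 <= psi v)%R ->
  \int[P]_w
    (psi (V w) * station_overlap (delta (V w)) (X i w) (X j w) ^+ p)%:E =
  (p`!%:R / (2 * mu) ^+ p)%:E *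
  \int[P]_w (psi (V w) * expR (- mu * `|delta (V w)|))%:E.
Proof.
move=> p2 md mpsi psi0; have [mutX lawX] := expX.
have Di : D i by apply: ijD; rewrite /= !inE eqxx.
have mo : measurable_fun setT (fun z : T' * R * R =>
    station_overlap (delta z.1.1) z.1.2 z.2 ^+ p)%R.
  apply: measurable_funX; apply: measurable_station_overlap => //.
  - by apply: measurableT_comp => //; exact: measurableT_comp.
  - exact: measurableT_comp.
rewrite (integral_independent_cylinder2 (f := fun z => (psi z.1.1 *
    station_overlap (delta z.1.1) z.1.2 z.2 ^+ p)%:E)); last 2 first.
- apply/measurable_EFinP; apply: measurable_funM => //.
  by apply: measurableT_comp => //; exact: measurableT_comp.
- by move=> z; rewrite lee_fin mulr_ge0// exprn_ge0// station_overlap_ge0.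
rewrite -ge0_integralZl//; last 3 first.
- apply/measurable_EFinP; apply: measurable_funM => //.
    exact: (measurableT_comp mpsi).
  apply: measurableT_comp => //; apply: measurable_funM => //.
  by apply: measurableT_comp => //; exact: (measurableT_comp md).
- by move=> w _; rewrite lee_fin mulr_ge0// expR_ge0.
- by rewrite lee_fin divr_ge0// exprn_ge0// mulr_ge0// ltW.
apply: eq_integral => w _ /=.
transitivity ((psi (V w))%:E *
    (p`!%:R / (2 * mu) ^+ p * expR (- mu * `|delta (V w)|))%:E); last first.
  by rewrite -!EFinM; congr EFin; ring.
rewrite -(@station_overlap_moment _ mu (distribution P (X i)) mu_gt0 (lawX i Di))//.
have mo2 : measurable_fun setT (fun z : R * R =>
    (station_overlap (delta (V w)) z.1 z.2 ^+ p)%:E).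
  by apply/measurable_EFinP; apply: measurable_funX;
    exact: measurable_station_overlap.
have o0 (z : R * R) : 0 <= (station_overlap (delta (V w)) z.1 z.2 ^+ p)%:E.
  by rewrite lee_fin exprn_ge0// station_overlap_ge0.
rewrite -ge0_integralZl//; last 3 first.
- exact: (measurable_fun_fubini_tonelli_F _ mo2 o0).
- by move=> x _; apply: integral_ge0 => y _; exact: (o0 (x, y)).
- by rewrite lee_fin.
apply: eq_integral => x _; rewrite -ge0_integralZl//; last 3 first.
- by apply/measurable_EFinP; apply: measurable_funX;
    exact: measurable_station_overlap.
- by move=> y _; exact: (o0 (x, y)).
- by rewrite lee_fin.
Qed.

End overlap_expectations.

(** * Moments of the two overlaps *)

Section second_moment.
Local Open Scope ereal_scope.
Context d (T : measurableType d) (R : realType) (P : probability T R).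

(** In this form, square integrability is read off the second moment. *)
Lemma Lfun2_sqr_lty (f : T -> R) : measurable_fun setT f ->
  \int[P]_w (f w ^+ 2)%:E < +oo -> f \in Lfun P 2%:E.
Proof.
move=> mf fi; rewrite inE; apply/andP; split; first by rewrite inE.
rewrite inE/= /finite_norm unlock.
rewrite poweR_lty//.
rewrite (eq_integral (fun w => (f w ^+ 2)%:E))// => w _.
by rewrite /= powR_mulrn// -normrX ger0_norm// sqr_ge0.
Qed.

Lemma expectation_of_integral (f : T -> R) (r : \bar R) :
  \int[P]_w (f w)%:E = r -> 'E_P[f] = r.
Proof. by rewrite unlock. Qed.

Lemma variance_of_moments (f : T -> R) (e s : R) : measurable_fun setT f ->
  \int[P]_w (f w)%:E = e%:E -> \int[P]_w (f w ^+ 2)%:E = s%:E ->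
  'V_P[f] = (s - e ^+ 2)%:E.
Proof.
move=> mf fe fs.
have f2 : f \in Lfun P 2%:E by apply: Lfun2_sqr_lty; rewrite // fs ltry.
by rewrite varianceE// !(expectation_of_integral (f := f) fe)
  (expectation_of_integral (f := (f ^+ 2)%R) fs) -EFin_expe -EFinB.
Qed.

Lemma covariance_of_moments (f g : T -> R) (e1 e2 s1 s2 c : R) :
  measurable_fun setT f -> measurable_fun setT g ->
  \int[P]_w (f w)%:E = e1%:E -> \int[P]_w (f w ^+ 2)%:E = s1%:E ->
  \int[P]_w (g w)%:E = e2%:E -> \int[P]_w (g w ^+ 2)%:E = s2%:E ->
  \int[P]_w (f w * g w)%:E = c%:E ->
  covariance P f g = (c - e1 * e2)%:E.
Proof.
move=> mf mg fe fs ge gs fg.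
have f2 : f \in Lfun P 2%:E by apply: Lfun2_sqr_lty; rewrite // fs ltry.
have g2 : g \in Lfun P 2%:E by apply: Lfun2_sqr_lty; rewrite // gs ltry.
rewrite covarianceE//.
- by rewrite (expectation_of_integral fe) (expectation_of_integral ge)
    (expectation_of_integral (f := (f * g)%R) fg) -EFinM -EFinB.
- by apply: Lfun_subset12; rewrite ?fin_num_measure.
- by apply: Lfun_subset12; rewrite ?fin_num_measure.
- exact: Lfun2_mul_Lfun1.
Qed.
End second_moment.

Lemma measurable_overlap d (T : measurableType d) (R : realType)
    (P : probability T R) (A : nat -> {RV P >-> R})
    (S : nat -> nat -> {RV P >-> R}) (j m n : nat) :
  measurable_fun setT (overlap A S j m n).
Proof.
have mdep l i : measurable_fun setT (departure A S l i).
  by apply: measurable_funD => //; apply: measurable_sum.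
apply: measurable_maxr => //; apply: measurable_funB.
- exact: measurable_minr.
- exact: measurable_maxr.
Qed.

Section tandem_overlaps.
Local Open Scope ereal_scope.
Context d (T : measurableType d) (R : realType) (P : probability T R).
Variables (lambda mu : R) (A : nat -> {RV P >-> R}).
Variables (S : nat -> nat -> {RV P >-> R}) (n k : nat).
Hypotheses (lambda_gt0 : (0 < lambda)%R) (mu_gt0 : (0 < mu)%R).
Hypotheses (n_ge1 : (1 <= n)%N) (k_ge1 : (1 <= k)%N).
Hypothesis queue : is_tandem_queue lambda mu A S.

Let service (ji : nat * nat) : {RV P >-> R} := S ji.1 ji.2.
Let gap : {RV P >-> R} := (A (n + k) - A n)%R.
Let r : R := (lambda / (lambda + mu))%R.

Lemma overlap1E w : overlap A S 1 n (n + k) w =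
  station_overlap (gap w) (S 1%N n w) (S 1%N (n + k)%N w).
Proof.
by rewrite /overlap /departure /= !big_nat1 !big_geq// !addr0 station_overlapE.
Qed.

Lemma overlap2E w : overlap A S 2 n (n + k) w =
  station_overlap (gap w + S 1%N (n + k)%N w - S 1%N n w)
    (S 2%N n w) (S 2%N (n + k)%N w).
Proof.
have sum2 i : (\sum_(1 <= l < 3) S l i w = S 1%N i w + S 2%N i w)%R.
  by rewrite big_nat_recr//= big_nat1.
rewrite /overlap /departure /= !sum2 !big_nat1 !addrA.
rewrite station_overlapE; congr station_overlap.
transitivity ((A (n + k) w - A n w) + S 1%N (n + k)%N w - S 1%N n w)%R => //; ring.
Qed.

Let independent_gap (J : {fset nat * nat}) :
  [set` J] `<=` service_index -> independent_of P (cylinders service J) gap.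
Proof.
move=> JD E C JE mC; rewrite setIC muleC; apply: (tandem_independent queue).
  by apply: generated_sigma_algebraD => //=; rewrite (leq_trans n_ge1)// leq_addr.
exact: cylinders_generated JE.
Qed.

Let i1 : nat * nat := (1, n)%N.
Let j1 : nat * nat := (1, n + k)%N.
Let i2 : nat * nat := (2, n)%N.
Let j2 : nat * nat := (2, n + k)%N.

Let services_sub : [set` [fset i1; j1; i2; j2]%fset] `<=` service_index.
Proof.
have nk : (1 <= n + k)%N by rewrite (leq_trans n_ge1)// leq_addr.
by move=> ji /=; rewrite !inE => /orP[/orP[/orP[]|]|] /eqP ->.
Qed.

Let n_neq_nk : (n == n + k)%N = false.
Proof. by rewrite -[X in X == _]addn0 eqn_add2l eq_sym gtn_eqF. Qed.

(* What the lag at station 2 depends on. *)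
Let V : {RV P >-> (R * R * R)%type} :=
  pairRV (pairRV gap (service i1)) (service j1).

Let independent_V : independent_of P (cylinders service [fset i2; j2]%fset) V.
Proof.
have [mutS _] := tandem_services queue.
apply: (independent_of_cylinders_pair mutS).
- apply: subset_trans services_sub => ji /=; rewrite !inE.
  by move=> /orP[->|/orP[->|->]]; rewrite ?orbT.
- by rewrite !inE.
apply: (independent_of_cylinders_pair mutS).
- apply: subset_trans services_sub => ji /=; rewrite !inE.
  by move=> /orP[->|/orP[->|/orP[->|->]]]; rewrite ?orbT.
- by rewrite !inE /i1 /j1 /i2 /j2 !xpair_eqE n_neq_nk.
apply: independent_gap.
apply: subset_trans services_sub => ji /=; rewrite !inE.
by move=> /orP[->|/orP[->|/orP[->|->]]]; rewrite ?orbT.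
Qed.

Let i1j1 : i1 != j1. Proof. by rewrite xpair_eqE n_neq_nk andbF. Qed.
Let i2j2 : i2 != j2. Proof. by rewrite xpair_eqE n_neq_nk andbF. Qed.

Let first_sub : [set` [fset i1; j1]%fset] `<=` service_index.
Proof.
apply: subset_trans services_sub => ji /=; rewrite !inE.
by move=> /orP[->|->]; rewrite ?orbT.
Qed.

Let second_sub : [set` [fset i2; j2]%fset] `<=` service_index.
Proof.
apply: subset_trans services_sub => ji /=; rewrite !inE.
by move=> /orP[->|->]; rewrite ?orbT.
Qed.

Let nu : probability R R := distribution P (service i1).

Let nuE B : measurable B -> nu B = exponential_prob mu B.
Proof.
by move=> mB; apply: (proj2 (tandem_services queue)) => //; exact: first_sub.
Qed.

Lemma integral_overlap1 (p : nat) : (0 < p <= 2)%N ->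
  \int[P]_w (overlap A S 1 n (n + k) w ^+ p)%:E =
  (p`!%:R / (2 * mu) ^+ p * r ^+ k)%:E.
Proof.
move=> p2.
under eq_integral do rewrite overlap1E -[X in X%:E]mul1r.
rewrite (integral_overlap mu_gt0 (tandem_services queue) i1j1 first_sub
  (independent_gap first_sub) (delta := id) (psi := cst 1%R) p2)//.
rewrite (integral_gap (a := 1) (b := 0) (mu := mu) lambda_gt0 n_ge1
  (tandem_arrivals queue)
  (h := fun g => (1 * expR (- mu * `|g|))%:E))//.
- by rewrite -EFinM; congr EFin; rewrite /r; ring.
- apply/measurable_EFinP; apply: measurable_funM => //.
  by apply: measurableT_comp => //; apply: measurable_funM => //;
    exact: measurableT_comp.
- by move=> s s0; rewrite ger0_norm// mul0r addr0.
Qed.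

(** With [V] the triple of the gap and of the two services at station 1, the
    lag at station 2 is a function of [V]; the hypothesis on [psi] integrates
    those two services out, and [integral_gap] the gap. *)
Lemma integral_overlap2 (p : nat) (psi : R * R * R -> R) (a b : R) :
  (0 < p <= 2)%N -> measurable_fun setT psi -> (forall v, 0 <= psi v)%R ->
  (0 <= a)%R -> (0 <= b)%R ->
  (forall s, (0 <= s)%R -> \int[nu]_x \int[nu]_y
     (psi (s, x, y) * expR (- mu * `|s + y - x|))%:E =
     ((a + b * s) * expR (- mu * s))%:E) ->
  \int[P]_w (psi (V w) * overlap A S 2 n (n + k) w ^+ p)%:E =
  (p`!%:R / (2 * mu) ^+ p * (r ^+ k * (a + b * k%:R / (lambda + mu))))%:E.
Proof.
move=> p2 mpsi psi0 a0 b0 psiE.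
(* The lag at station 2. *)
pose delta (v : R * R * R) := (v.1.1 + v.2 - v.1.2)%R.
have mdelta : measurable_fun setT delta.
  apply: measurable_funB; last exact: measurableT_comp.
  by apply: measurable_funD => //; exact: measurableT_comp.
under eq_integral do rewrite overlap2E.
rewrite (integral_overlap mu_gt0 (tandem_services queue) i2j2 second_sub
  independent_V (delta := delta) (psi := psi) p2)//.
pose f (v : R * R * R) := (psi v * expR (- mu * `|delta v|))%:E.
have mf : measurable_fun setT f.
  apply/measurable_EFinP; apply: measurable_funM => //.
  apply: measurableT_comp => //; apply: measurable_funM => //.
  exact: measurableT_comp.
have f0 v : 0 <= f v by rewrite lee_fin mulr_ge0// expR_ge0.
rewrite (integral_independent_cylinder2 (tandem_services queue) i1j1 first_sub
  (independent_gap first_sub) (f := f))//.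
have mf1 := measurable_fun_fubini_tonelli_F (m2 := nu) f mf f0.
have f10 z : 0 <= fubini_F nu f z by apply: integral_ge0.
have mf2 := measurable_fun_fubini_tonelli_F (m2 := nu) _ mf1 f10.
rewrite (integral_gap (a := a) (b := b) (mu := mu) lambda_gt0 n_ge1
  (tandem_arrivals queue)
  (h := fubini_F nu (fubini_F nu f)))//.
by move=> s; apply: integral_ge0.
Qed.

Lemma integral_overlap2_pow (p : nat) : (0 < p <= 2)%N ->
  \int[P]_w (overlap A S 2 n (n + k) w ^+ p)%:E =
  (p`!%:R / (2 * mu) ^+ p *
    (r ^+ k * (2^-1 + mu / 2 * k%:R / (lambda + mu))))%:E.
Proof.
move=> p2; under eq_integral do rewrite -[X in X%:E]mul1r.
rewrite (integral_overlap2 (psi := cst 1%R) (a := 2^-1) (b := mu / 2))//.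
  by rewrite divr_ge0// ltW.
move=> s s0 /=; rewrite -(expRN_next_gap mu_gt0 nuE s0).
by apply: eq_integral => x _; apply: eq_integral => y _; rewrite mul1r.
Qed.

Lemma integral_overlap12 :
  \int[P]_w (overlap A S 1 n (n + k) w * overlap A S 2 n (n + k) w)%:E =
  (1`!%:R / (2 * mu) ^+ 1 * (r ^+ k * (4 * mu)^-1))%:E.
Proof.
under eq_integral do rewrite overlap1E -[overlap A S 2 n (n + k) _]expr1.
rewrite (integral_overlap2 (psi := fun v => station_overlap v.1.1 v.1.2 v.2)
  (a := (4 * mu)^-1) (b := 0))//.
- by rewrite !mul0r addr0.
- apply: measurable_station_overlap => //; exact: measurableT_comp.
- by move=> v; exact: station_overlap_ge0.
- by rewrite invr_ge0 mulr_ge0// ltW.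
- by move=> s s0; rewrite mul0r addr0 -(station_overlap_next mu_gt0 nuE s0).
Qed.

End tandem_overlaps.

Theorem proposition3p4 (d : measure_display) (T : measurableType d)
    (R : realType) (P : probability T R) (lambda mu : R)
    (A : nat -> {RV P >-> R}) (S : nat -> nat -> {RV P >-> R}) (n k : nat)
    (lambda_gt0 : 0 < lambda) (mu_gt0 : 0 < mu)
    (n_ge1 : (1 <= n)%N) (k_ge1 : (1 <= k)%N)
    (queue : is_tandem_queue lambda mu A S) :
  let O1 := overlap A S 1 n (n + k) in
  let O2 := overlap A S 2 n (n + k) in
  let r := lambda / (lambda + mu) in
  [/\ 'E_P[ O1 ]%E = (r ^+ k * (1 / (2 * mu)))%:E,
      'E_P[ O2 ]%E = (1 / (4 * mu) * r ^+ k
                    + k%:R / 4 * r ^+ k * (1 / (lambda + mu)))%:E,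
      'V_P[ O1 ]%E = (r ^+ k * (1 / (2 * mu ^+ 2))
                    - r ^+ (2 * k) * (1 / (4 * mu ^+ 2)))%:E,
      'V_P[ O2 ]%E = (r ^+ k * (1 / (4 * mu ^+ 2))
                    + 1 / (4 * mu ^+ 2) * r ^+ k * (mu / (lambda + mu)) * k%:R
                    - (1 / (4 * mu) * r ^+ k
                       + k%:R / 4 * r ^+ k * (1 / (lambda + mu))) ^+ 2)%:E
    & covariance P O1 O2 =
        (1 / (8 * mu ^+ 2) * r ^+ k
         - 1 / (8 * mu ^+ 2) * r ^+ (2 * k)
           * (1 + k%:R * mu / (lambda + mu)))%:E].
Proof.
move=> O1 O2 r.
have m1 : measurable_fun setT O1 := measurable_overlap A S 1 n (n + k).
have m2 : measurable_fun setT O2 := measurable_overlap A S 2 n (n + k).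
have := integral_overlap1 lambda_gt0 mu_gt0 n_ge1 k_ge1 queue (p := 1) isT.
have s1 := integral_overlap1 lambda_gt0 mu_gt0 n_ge1 k_ge1 queue (p := 2) isT.
under eq_integral do rewrite expr1; move=> e1.
have := integral_overlap2_pow lambda_gt0 mu_gt0 n_ge1 k_ge1 queue (p := 1) isT.
have s2 := integral_overlap2_pow lambda_gt0 mu_gt0 n_ge1 k_ge1 queue (p := 2) isT.
under eq_integral do rewrite expr1; move=> e2.
have c := integral_overlap12 lambda_gt0 mu_gt0 n_ge1 k_ge1 queue.
have mu0 : mu != 0 by rewrite gt_eqF.
have lm0 : lambda + mu != 0 by rewrite gt_eqF// addr_gt0.
split.
- rewrite (expectation_of_integral e1); congr EFin; rewrite -/r factS fact0 muln1.
  by field.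
- rewrite (expectation_of_integral e2); congr EFin; rewrite -/r factS fact0 muln1.
  by field; rewrite mu0 lm0.
- rewrite (variance_of_moments m1 e1 s1); congr EFin.
  rewrite -/r !factS fact0 !muln1 mulnC exprM.
  by field.
- rewrite (variance_of_moments m2 e2 s2); congr EFin.
  rewrite -/r !factS fact0 !muln1.
  by field; rewrite mu0 lm0.
- rewrite (covariance_of_moments m1 m2 e1 s1 e2 s2 c); congr EFin.
  rewrite -/r !factS fact0 !muln1 mulnC exprM.
  by field; rewrite mu0 lm0.
Qed.
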